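(* Let $(\Omega,\Sigma,\mu)$ be an admissible measure space. (a) The map $E\mapsto E_0$, regarded as a map $\mathcal{J}_0(\mu)\to\mathcal{J}_0(\mu)$, is a closure operator on $\langle\mathcal{J}_0(\mu),\vartriangleleft\rangle$, where $E\vartriangleleft F$ means $F\subset^1E$; that is, for all $E,F\in\mathcal{J}_0(\mu)$: $E_0\in\mathcal{J}_0(\mu)$; $F\subset^1E$ implies $F_0\subset^1E_0$; $E_0\subset^1E$; and $(E_0)_0=E_0$. (b) The map $E\mapsto E''$, regarded as a map $\mathcal{J}_0(\mu)\to\mathcal{J}_0(\mu)$, is a closure operator with respect to $\subset^1$; that is, for all $E,F\in\mathcal{J}_0(\mu)$: $E''\in\mathcal{J}_0(\mu)$; $E\subset^1F$ implies $E''\subset^1F''$; $E\subset^1E''$; and $(E'')''=E''$.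
   Context: $L_0(\mu)$: classes of measurable real functions ordered a.e. Admissible measure space: $\mu$ complete; a set whose intersection with every finite-measure measurable set is measurable is itself measurable; $\mu$ semifinite; $\mu$ has the direct sum property. A Banach ideal space (BIS) is a vector subspace $E\subset L_0(\mu)$ with complete norm such that $y\in E$, $|x|\le|y|$ a.e. imply $x\in E$, $\|x\|_E\le\|y\|_E$; maximal width: the only $z\in L_0(\mu)$ with $zy=0$ for all $y\in E$ is $z=0$. $E\subset^1F$: $E\subseteq F$ and $\|x\|_F\le\|x\|_E$ for $x\in E$; equality means equal sets with equal norms. Dual $E'$: all $f\in L_0(\mu)$ with $\|f\|_{E'}=\sup\{\int_\Omega fx\,d\mu:\|x\|_E=1\}<\infty$. $E_0$: the elements $x\in E$ with order continuous norm (for every decreasing net $|x|\ge x_i\downarrow0$, $\|x_i\|_E\to0$), with the norm of $E$. A foundation in $E$ is an ideal of $E$ of maximal width. $\mathcal{J}_0(\mu)$: BIS $E$ of maximal width such that $E_0$ is a foundation in $E$ and $(E')_0$ is a foundation in $E'$. A closure operator $\pi$ on a poset $\langle L,<\rangle$ satisfies: $a<b\Rightarrow\pi(a)<\pi(b)$, $a<\pi(a)$, $\pi(\pi(a))=\pi(a)$. *)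

(* Defs.v *)
From HB Require Import structures.
From mathcomp Require Import all_boot all_order all_algebra.
From mathcomp Require Import all_classical all_reals all_analysis.
Set Implicit Arguments. Unset Strict Implicit. Unset Printing Implicit Defensive.
Import Order.TTheory GRing.Theory Num.Theory.
Local Open Scope classical_set_scope.
Local Open Scope ring_scope.

Section BIS.
Context {d : measure_display} {T : measurableType d} {R : realType}
        (mu : {measure set T -> \bar R}).

Definition mu_complete : Prop :=
  forall N, measurable N -> mu N = 0%E -> forall A, A `<=` N -> measurable A.

Definition mu_locally_determined : Prop :=
  forall A : set T,
    (forall B, measurable B -> (mu B < +oo)%E -> measurable (A `&` B)) ->
    measurable A.

Definition mu_semifinite : Prop :=
  forall A, measurable A -> mu A = +oo%E ->
    exists B, [/\ measurable B, B `<=` A & (0 < mu B < +oo)%E].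

Definition mu_direct_sum : Prop :=
  exists F : set (set T),
    [/\ (forall X, F X -> measurable X /\ (mu X < +oo)%E),
        (forall X Y, F X -> F Y -> X <> Y -> X `&` Y = set0),
        \bigcup_(X in F) X = setT,
        (forall A : set T, (forall X, F X -> measurable (A `&` X)) -> measurable A)
      & (forall A, measurable A -> mu A = \esum_(X in F) mu (A `&` X))].

Definition admissible : Prop :=
  [/\ mu_complete, mu_locally_determined, mu_semifinite & mu_direct_sum].

(* Elements of L_0(mu) are represented by measurable functions; a space is a
   set of such functions, saturated under a.e. equality, with a norm that is
   invariant under a.e. equality. *)
Record ispace := ISpace { ispace_set : set (T -> R);
                          ispace_norm : (T -> R) -> R }.

Definition mfun0 (x : T -> R) := measurable_fun setT x.

Definition ae_eq (x y : T -> R) := {ae mu, forall t, x t = y t}.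
Definition ae_le (x y : T -> R) := {ae mu, forall t, x t <= y t}.

Definition is_BIS (E : ispace) : Prop :=
  let S := ispace_set E in let n := ispace_norm E in
  [/\ (forall x, S x -> mfun0 x) /\
        (forall x y, S x -> mfun0 y -> ae_eq x y -> S y /\ n y = n x),
      S (fun=> 0) /\ (forall x y, S x -> S y -> S (x \+ y)) /\
        (forall (a : R) x, S x -> S (fun t => a * x t)),
      (forall x, S x -> 0 <= n x /\ (n x = 0 <-> ae_eq x (fun=> 0))) /\
        (forall (a : R) x, S x -> n (fun t => a * x t) = `|a| * n x) /\
        (forall x y, S x -> S y -> n (x \+ y) <= n x + n y),
      (forall u : nat -> T -> R, (forall k, S (u k)) ->
         (forall e : R, 0 < e -> exists N, forall m k, (N <= m)%N -> (N <= k)%N ->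
              n (u m \- u k) < e) ->
         exists2 x, S x & forall e : R, 0 < e -> exists N, forall k, (N <= k)%N ->
              n (u k \- x) < e)
    &
      (forall x y, S y -> mfun0 x -> ae_le (fun t => `|x t|) (fun t => `|y t|) ->
         S x /\ n x <= n y)].

Definition max_width (S : set (T -> R)) : Prop :=
  forall z, mfun0 z -> (forall y, S y -> ae_eq (z \* y) (fun=> 0)) ->
    ae_eq z (fun=> 0).

Definition sub1 (E F : ispace) : Prop :=
  ispace_set E `<=` ispace_set F /\
  forall x, ispace_set E x -> ispace_norm F x <= ispace_norm E x.

Definition ispace_eq (E F : ispace) : Prop :=
  ispace_set E = ispace_set F /\
  forall x, ispace_set E x -> ispace_norm E x = ispace_norm F x.

Definition dual_vals (E : ispace) (f : T -> R) : set R :=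
  [set Rintegral mu setT (fun t => f t * x t) | x in
     [set x | ispace_set E x /\ ispace_norm E x = 1]].

Definition dual (E : ispace) : ispace :=
  ISpace [set f | mfun0 f /\
                  (forall x, ispace_set E x ->
                     mu.-integrable setT (fun t => (f t * x t)%:E)) /\
                  has_ubound (dual_vals E f)]
         (fun f => sup (dual_vals E f)).

Definition order_continuous_elt (E : ispace) (x : T -> R) : Prop :=
  ispace_set E x /\
  forall (I : Type) (le : I -> I -> Prop) (xs : I -> T -> R),
    inhabited I -> (forall i, le i i) ->
    (forall i j k, le i j -> le j k -> le i k) ->
    (forall i j, exists k, le i k /\ le j k) ->
    (forall i, mfun0 (xs i)) ->
    (forall i, ae_le (xs i) (fun t => `|x t|)) ->
    (forall i j, le i j -> ae_le (xs j) (xs i)) ->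
    (forall i, ae_le (fun=> 0) (xs i)) ->
    (forall z, mfun0 z -> (forall i, ae_le z (xs i)) -> ae_le z (fun=> 0)) ->
    forall e : R, 0 < e -> exists i0, forall i, le i0 i -> ispace_norm E (xs i) < e.

Definition ocpart (E : ispace) : ispace :=
  ISpace (order_continuous_elt E) (ispace_norm E).

Definition is_ideal_of (S : set (T -> R)) (E : ispace) : Prop :=
  [/\ S `<=` ispace_set E, S (fun=> 0),
      (forall x y, S x -> S y -> S (x \+ y)),
      (forall (a : R) x, S x -> S (fun t => a * x t))
    & (forall x y, S y -> ispace_set E x ->
         ae_le (fun t => `|x t|) (fun t => `|y t|) -> S x)].

Definition foundation (S : set (T -> R)) (E : ispace) : Prop :=
  is_ideal_of S E /\ max_width S.

Definition J0 (E : ispace) : Prop :=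
  [/\ is_BIS E, max_width (ispace_set E),
      foundation (ispace_set (ocpart E)) E
    & foundation (ispace_set (ocpart (dual E))) (dual E)].

End BIS.

(* Main.v *)
(* If [E] is contained in [F] with a smaller norm in [F], a net witnessing a
   failure of order continuity in [F] of an element of [E] witnesses it in [E]
   too; hence [E_0] is contained in [F_0].  This gives the monotonicity of
   [E |-> E_0] and, applied to [E <= E''], [E' <= (E_0)'] and [E' <= E'''], it
   transfers the maximal width of [E_0] and [(E')_0] to [(E'')_0], [((E_0)')_0]
   and [(E''')_0].  Norm closedness of [E_0] makes it complete.  Completeness of
   [E'] needs no gluing of local limits: if the increments of a sequence in [E']
   have summable norms, they are absolutely summable a.e. on the support of each
   element of [E], hence a.e. because [E] has maximal width, and Fatou's lemma
   shows that the a.e. limit is a limit in norm. *)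
From Pilot Require (* Takes [mfun0] and [ae_eq] back from MathComp-Analysis. *)
Import Defs.
From HB Require Import structures.
From mathcomp Require Import all_boot all_order all_algebra.
From mathcomp Require Import all_classical all_reals all_analysis.
From mathcomp Require Import measurable_realfun ring lra.
Import Defs.
Set Implicit Arguments. Unset Strict Implicit. Unset Printing Implicit Defensive.
Import Order.TTheory GRing.Theory Num.Theory.
Import numFieldNormedType.Exports.
Local Open Scope classical_set_scope.
Local Open Scope ring_scope.

Section BanachIdealSpaces.
Context {d : measure_display} {T : measurableType d} {R : realType}
        (mu : {measure set T -> \bar R}).
Implicit Types (E F : @ispace _ T R) (x y z f g : T -> R).

Local Notation BIS := (is_BIS mu).

(** * Measurability of pointwise operations, and solidity *)

Lemma mfun0_norm f : mfun0 f -> mfun0 (fun t => `|f t|).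
Proof. move=> mf; exact: (measurableT_comp (@normr_measurable R setT) mf). Qed.

Lemma mfun0M f g : mfun0 f -> mfun0 g -> mfun0 (fun t => f t * g t).
Proof. move=> mf mg; exact: (measurable_funM mf mg). Qed.

Lemma mfun0B f g : mfun0 f -> mfun0 g -> mfun0 (f \- g).
Proof. move=> mf mg; exact: (measurable_funB mf mg). Qed.

Lemma mfun0_cst (a : R) : mfun0 (fun _ : T => a).
Proof. exact: measurable_cst. Qed.

Lemma mfun0_min_norm f g : mfun0 f -> mfun0 g ->
  mfun0 (fun t => Num.min (f t) `|g t|).
Proof. move=> mf mg; exact: (measurable_minr mf (mfun0_norm mg)). Qed.

Lemma is_BIS_between E x y : BIS E -> ispace_set E y -> mfun0 x ->
  ae_le mu (fun=> 0) x -> ae_le mu x (fun t => `|y t|) ->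
  ispace_set E x /\ ispace_norm E x <= ispace_norm E y.
Proof.
case=> _ _ _ _ solid Ey mx x0 xy; apply: solid => //.
by apply: filterS2 x0 xy => t /= x0 xy; rewrite ger0_norm.
Qed.

(** * Nets decreasing to zero below a given function *)

(** Bundles the premises on a net in [order_continuous_elt]. The conditions on the index set form
    the first half, which stays untouched when the functions of the net are changed. *)
Definition dominated_null_net (I : Type) (le : I -> I -> Prop)
    (xs : I -> T -> R) x : Prop :=
  (inhabited I /\ (forall i, le i i) /\
   (forall i j k, le i j -> le j k -> le i k) /\
   (forall i j, exists k, le i k /\ le j k)) /\
  ((forall i, mfun0 (xs i)) /\
   (forall i, ae_le mu (xs i) (fun t => `|x t|)) /\
   (forall i j, le i j -> ae_le mu (xs j) (xs i)) /\
   (forall i, ae_le mu (fun=> 0) (xs i)) /\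
   (forall z, mfun0 z -> (forall i, ae_le mu z (xs i)) -> ae_le mu z (fun=> 0))).

Definition eventually_below (I : Type) (le : I -> I -> Prop) (a : I -> R) :=
  forall e : R, 0 < e -> exists i0, forall i, le i0 i -> a i < e.

Lemma order_continuous_eltP E x : order_continuous_elt mu E x <->
  ispace_set E x /\
  forall (I : Type) (le : I -> I -> Prop) (xs : I -> T -> R),
    dominated_null_net le xs x -> eventually_below le (ispace_norm E \o xs).
Proof.
split=> -[Ex H]; split=> // I le xs.
  by move=> [[? [? [? ?]]] [? [? [? [? ?]]]]] e e0; apply: H.
by move=> ? ? ? ? ? ? ? ? ? e e0; apply: H.
Qed.

Lemma dominated_null_net_solid I le (xs : I -> T -> R) x y :
  dominated_null_net le xs x -> ae_le mu (fun t => `|x t|) (fun t => `|y t|) ->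
  dominated_null_net le xs y.
Proof.
move=> [? [? [xsx H]]] xy; split => //; split=> //; split=> // i.
by apply: filterS2 (xsx i) xy => t /= ?; apply: le_trans.
Qed.

(** A lower bound of the truncations is also a lower bound of [xs], so the infimum remains zero. *)
Lemma dominated_null_net_min I le (xs : I -> T -> R) x y :
  dominated_null_net le xs x -> mfun0 y ->
  dominated_null_net le (fun i t => Num.min (xs i t) `|y t|) y.
Proof.
move=> [? [mxs [xsx [mono [xs0 inf]]]]] my; split => //; split; last split; last split; last split.
- by move=> i; exact: mfun0_min_norm.
- by move=> i; apply: aeW => t; rewrite ge_min lexx orbT.
- move=> i j ij; apply: filterS (mono _ _ ij) => t h.
  by rewrite le_min !ge_min h lexx orbT.
- by move=> i; apply: filterS (xs0 i) => t h; rewrite le_min h /=.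
- move=> z mz zle; apply: inf => // i; apply: filterS (zle i) => t.
  by rewrite le_min => /andP[].
Qed.

Lemma dominated_null_netZ I le (xs : I -> T -> R) x (a : R) : 0 < a ->
  dominated_null_net le xs (fun t => a * x t) ->
  dominated_null_net le (fun i t => a^-1 * xs i t) x.
Proof.
move=> a0 [? [mxs [xsx [mono [xs0 inf]]]]]; split => //; split; last split; last split; last split.
- by move=> i; exact: mfun0M (mfun0_cst _) (mxs i).
- move=> i; apply: filterS (xsx i) => t.
  by rewrite normrM (gtr0_norm a0) ler_pdivrMl.
- by move=> i j ij; apply: filterS (mono _ _ ij) => t h; rewrite ler_pM2l ?invr_gt0.
- by move=> i; apply: filterS (xs0 i) => t h; rewrite mulr_ge0 // invr_ge0 ltW.
- move=> z mz zle.
  have : ae_le mu (fun t => a * z t) (fun=> 0).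
    apply: inf => [|i]; first exact: mfun0M (mfun0_cst _) mz.
    by apply: filterS (zle i) => t; rewrite ler_pdivlMl.
  by apply: filterS => t; rewrite pmulr_rle0.
Qed.

(** The remainder is the positive part of [xs i - |y|]. It is therefore monotone in [xs i], at most
    [|x| - |y|] wherever it is nonzero, and at most [xs i], which gives the infimum zero. *)
Lemma dominated_null_net_rest I le (xs : I -> T -> R) x y :
  dominated_null_net le xs x -> mfun0 y ->
  dominated_null_net le (fun i t => xs i t - Num.min (xs i t) `|y t|) (x \- y).
Proof.
move=> [? [mxs [xsx [mono [xs0 inf]]]]] my; split => //; split; last split; last split; last split.
- by move=> i; exact: mfun0B (mxs i) (mfun0_min_norm (mxs i) my).
- move=> i; apply: filterS (xsx i) => t h /=.
  case: (leP (xs i t) `|y t|) => h'; first by rewrite subrr.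
  by apply: le_trans (lerB_dist _ _); rewrite lerB.
- move=> i j ij; apply: filterS (mono _ _ ij) => t.
  by case: (leP (xs i t) `|y t|); case: (leP (xs j t) `|y t|) => *; lra.
- by move=> i; apply: aeW => t; rewrite subr_ge0 ge_min lexx.
- move=> z mz zle; apply: inf => // i; apply: filterS2 (zle i) (xs0 i) => t h h'.
  by apply: (le_trans h); rewrite gerBl le_min h' /=.
Qed.

(* A net below [|x|] is the sum of its truncation at [|y|] and of a remainder
   below [|x - y|]. *)
Lemma norm_dominated_null_net E x y I le (xs : I -> T -> R) i : BIS E ->
  ispace_set E x -> ispace_set E y -> dominated_null_net le xs x ->
  ispace_norm E (xs i) <=
    ispace_norm E (fun t => Num.min (xs i t) `|y t|) +
    ispace_norm E (fun t => xs i t - Num.min (xs i t) `|y t|).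
Proof.
move=> bE Ex Ey xsP.
case: (bE) => -[mE _] [_ [ED EZ]] [_ [_ nD]] _ _.
have [_ [mm [my [_ [m0 _]]]]] := dominated_null_net_min xsP (mE _ Ey).
have [_ [md [dxy [_ [d0 _]]]]] := dominated_null_net_rest xsP (mE _ Ey).
have Exy : ispace_set E (x \- y).
  rewrite (_ : x \- y = x \+ (fun t => -1 * y t)); first by apply: ED => //; exact: EZ.
  by apply/funext => t /=; rewrite mulN1r.
have [Em _] := is_BIS_between bE Ey (mm i) (m0 i) (my i).
have [Ed _] := is_BIS_between bE Exy (md i) (d0 i) (dxy i).
apply: le_trans (nD _ _ Em Ed); rewrite le_eqVlt; apply/orP; left; apply/eqP.
by congr ispace_norm; apply/funext => t /=; rewrite addrC subrK.
Qed.

(** * The order continuous part as a norm closed ideal *)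

Lemma order_continuous_solid E x y : BIS E -> order_continuous_elt mu E y ->
  mfun0 x -> ae_le mu (fun t => `|x t|) (fun t => `|y t|) ->
  order_continuous_elt mu E x.
Proof.
move=> bE /order_continuous_eltP[Ey ocy] mx xy; apply/order_continuous_eltP.
split; first by case: bE => _ _ _ _ /(_ x y Ey mx xy)[].
by move=> I le xs /dominated_null_net_solid/(_ xy)/ocy.
Qed.

(** Split a net below [|x + y|] at [|x|]: the truncation is dominated by [x] and the remainder by
    [(x + y) - x = y]. Each has norm below [e / 2] from some index on, and directedness gives a
    common index. *)
Lemma order_continuousD E x y : BIS E ->
  order_continuous_elt mu E x -> order_continuous_elt mu E y ->
  order_continuous_elt mu E (x \+ y).
Proof.
move=> bE /order_continuous_eltP[Ex ocx] /order_continuous_eltP[Ey ocy].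
case: (bE) => -[mE _] [_ [ED _]] _ _ _.
have Exy := ED _ _ Ex Ey.
apply/order_continuous_eltP; split=> // I le xs xsP e e0.
have e20 : 0 < e / 2 by rewrite divr_gt0.
have [i1 P1] := ocx _ _ _ (dominated_null_net_min xsP (mE _ Ex)) _ e20.
have yE : (x \+ y) \- x = y by apply/funext => t /=; rewrite addrC addKr.
have [i2 P2] : exists i2, forall i, le i2 i ->
    ispace_norm E (fun t => xs i t - Num.min (xs i t) `|x t|) < e / 2.
  by apply: (ocy I le) => //; rewrite -yE; exact: dominated_null_net_rest (mE _ Ex).
have [[_ [_ [tr dir]]] _] := xsP.
have [k [ik1 ik2]] := dir i1 i2; exists k => i ki /=.
apply: le_lt_trans (norm_dominated_null_net i bE Exy Ex xsP) _.
by rewrite [e]splitr ltrD //; [apply: P1|apply: P2]; apply: tr ki.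
Qed.

Lemma order_continuousZ E x (a : R) : BIS E -> order_continuous_elt mu E x ->
  order_continuous_elt mu E (fun t => a * x t).
Proof.
move=> bE /order_continuous_eltP[Ex ocx].
case: (bE) => -[mE _] [_ [_ EZ]] [_ [nZ _]] _ _.
apply/order_continuous_eltP; split; first exact: EZ.
move=> I le xs xsP e e0.
(* A zero factor cannot be inverted, but then the net lies below [0 * x] and all its norms
   vanish. *)
have [a0|a0] := eqVneq a 0.
  have [[[i] _] [mxs [xsx [_ [xs0 _]]]]] := xsP.
  exists i => j _ /=.
  have [_] := is_BIS_between bE (EZ a _ Ex) (mxs j) (xs0 j) (xsx j).
  by rewrite nZ // a0 normr0 mul0r => /le_lt_trans; apply.
have a_gt0 : 0 < `|a| by rewrite normr_gt0.
(* Only [|a * x|] matters, so [a] may be replaced by the positive factor [|a|]. *)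
have xsP' : dominated_null_net le xs (fun t => `|a| * x t).
  apply: dominated_null_net_solid xsP _.
  by apply: aeW => t; rewrite !normrM normr_id.
have [|i P] := ocx _ _ _ (dominated_null_netZ a_gt0 xsP') (e / `|a|).
  by rewrite divr_gt0.
have [_ [mxs [xsx [_ [xs0 _]]]]] := xsP.
exists i => j /P /=.
have [Exs _] := is_BIS_between bE (EZ a _ Ex) (mxs j) (xs0 j) (xsx j).
by rewrite nZ // normfV normr_id mulrC ltr_pM2r // invr_gt0.
Qed.

Lemma order_continuous_ideal E : BIS E -> is_ideal_of mu (order_continuous_elt mu E) E.
Proof.
move=> bE; have [[mE _] [E0 [_ EZ]] [_ [nZ _]] _ _] := bE.
split=> //.
- by move=> x [].
- apply/order_continuous_eltP; split=> // I le xs xsP e e0.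
  have [[[i] _] [mxs [xsx [_ [xs0 _]]]]] := xsP.
  exists i => j _ /=.
  have [_] := is_BIS_between bE E0 (mxs j) (xs0 j) (xsx j).
  move=> /le_lt_trans; apply; have := nZ 0 _ E0.
  under eq_fun do rewrite mul0r.
  by rewrite normr0 mul0r => ->.
- by move=> x y; exact: order_continuousD.
- by move=> a x; exact: order_continuousZ.
- by move=> x y ocy Ex; apply: order_continuous_solid => //; exact: mE.
Qed.

(** Truncate the net at [|y|] for some [y] in [E_0] close to [x]: order continuity of [y] controls
    the truncation, while the remainder is below [|x - y|] and so is uniformly small. *)
Lemma order_continuous_closed E x : BIS E -> ispace_set E x ->
  (forall e : R, 0 < e ->
     exists2 y, order_continuous_elt mu E y & ispace_norm E (x \- y) < e) ->
  order_continuous_elt mu E x.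
Proof.
move=> bE Ex approx.
case: (bE) => -[mE _] [_ [ED EZ]] [_ [nZ _]] _ _.
apply/order_continuous_eltP; split=> // I le xs xsP e e0.
have e20 : 0 < e / 2 by rewrite divr_gt0.
have [y /order_continuous_eltP[Ey ocy] xy] := approx _ e20.
have [i P] := ocy _ _ _ (dominated_null_net_min xsP (mE _ Ey)) _ e20.
have [_ [md [dxy [_ [d0 _]]]]] := dominated_null_net_rest xsP (mE _ Ey).
have Exy : ispace_set E (x \- y).
  rewrite (_ : x \- y = x \+ (fun t => -1 * y t)); first by apply: ED => //; exact: EZ.
  by apply/funext => t /=; rewrite mulN1r.
exists i => j ij /=.
apply: le_lt_trans (norm_dominated_null_net j bE Ex Ey xsP) _.
rewrite [e]splitr ltrD //; first exact: P.
have [_] := is_BIS_between bE Exy (md j) (d0 j) (dxy j).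
by move=> /le_lt_trans; apply.
Qed.

Lemma order_continuous_sub1 E F x : BIS E -> sub1 E F ->
  order_continuous_elt mu E x -> order_continuous_elt mu F x.
Proof.
move=> bE [EF nEF] /order_continuous_eltP[Ex ocx].
apply/order_continuous_eltP; split; first exact: EF.
move=> I le xs xsP e e0.
have [i P] := ocx _ _ _ xsP _ e0; exists i => j /P /=; apply: le_lt_trans.
have [_ [mxs [xsx [_ [xs0 _]]]]] := xsP.
by apply: nEF; case: (is_BIS_between bE Ex (mxs j) (xs0 j) (xsx j)).
Qed.

Lemma ocpart_sub1 E : sub1 (ocpart mu E) E.
Proof. by split=> [x []|]. Qed.

Lemma is_BIS_ocpart E : BIS E -> BIS (ocpart mu E).
Proof.
move=> bE; have [_ oc0 ocD ocZ _] := order_continuous_ideal bE.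
have [[mE eqE] [E0 [ED EZ]] [n0 [nZ nD]] cE idE] := bE.
split => /=.
- split; first by move=> x [/mE].
  move=> x y ocx my xy; split; last by case: ocx => Ex _; case: (eqE _ _ Ex my xy).
  apply: order_continuous_solid ocx my _ => //.
  by apply: filterS xy => t ->.
- by split=> //; split.
- split; first by move=> x [/n0].
  split; first by move=> a x [/nZ].
  by move=> x y [Ex _] [Ey _]; exact: nD.
- move=> u ocu /cE[k|x Ex ux]; first by case: (ocu k).
  exists x => //; apply: order_continuous_closed => // e e0.
  have [N uN] := ux _ e0; exists (u N) => //.
  have [Eu _] := ocu N.
  (* Completeness gives [u N - x] small; closedness asks for [x - u N]. *)
  suff -> : ispace_norm E (x \- u N) = ispace_norm E (u N \- x) by exact: uN.
  have Eux : ispace_set E (u N \- x).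
    rewrite (_ : _ \- x = u N \+ (fun t => -1 * x t)); first by apply: ED => //; exact: EZ.
    by apply/funext => t /=; rewrite mulN1r.
  have := nZ (-1) _ Eux; rewrite normrN1 mul1r => <-.
  by congr ispace_norm; apply/funext => t /=; rewrite mulN1r opprB.
- move=> x y ocy mx xy; split; first exact: order_continuous_solid ocy mx xy.
  by case: ocy => Ey _; case: (idE x y Ey mx xy).
Qed.

(** * The pairing of a space with its dual, and Hoelder's inequality *)

(** Taken in the extended reals, so that estimates make sense before integrability is known. *)
Definition abs_pairing f x : \bar R := (\int[mu]_t `|f t * x t|%:E)%E.

Lemma measurable_pairing f x : mfun0 f -> mfun0 x ->
  measurable_fun setT (fun t => (f t * x t)%:E).
Proof. by move=> mf mx; apply/measurable_EFinP; exact: mfun0M. Qed.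

Lemma measurable_abs_pairing f x : mfun0 f -> mfun0 x ->
  measurable_fun setT (fun t => `|f t * x t|%:E).
Proof. by move=> mf mx; apply/measurable_EFinP; apply: mfun0_norm; exact: mfun0M. Qed.

Lemma le_abs_pairing f g x y : mfun0 f -> mfun0 g -> mfun0 x -> mfun0 y ->
  {ae mu, forall t, `|f t * x t| <= `|g t * y t|} ->
  (abs_pairing f x <= abs_pairing g y)%E.
Proof.
move=> mf mg mx my h; apply: ae_ge0_le_integral => //.
- exact: measurable_abs_pairing.
- exact: measurable_abs_pairing.
- by apply: filterS h => t h _; rewrite lee_fin.
Qed.

Lemma abs_pairingZ (a : R) f x : mfun0 f -> mfun0 x ->
  abs_pairing (fun t => a * f t) x = (`|a|%:E * abs_pairing f x)%E.
Proof.
move=> mf mx; rewrite -ge0_integralZl_EFin //; last exact: measurable_abs_pairing.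
by apply: eq_integral => t _; rewrite -mulrA normrM EFinM.
Qed.

Lemma abs_pairingD f g x : mfun0 f -> mfun0 g -> mfun0 x ->
  (abs_pairing (f \+ g)%R x <= abs_pairing f x + abs_pairing g x)%E.
Proof.
move=> mf mg mx; rewrite -ge0_integralD //; try exact: measurable_abs_pairing.
apply: ge0_le_integral => //.
- by apply: measurable_abs_pairing => //; exact: (measurable_funD mf mg).
- by apply: emeasurable_funD; exact: measurable_abs_pairing.
- by move=> t _; rewrite -EFinD lee_fin mulrDl ler_normD.
Qed.

Lemma integrable_pairing f x : mfun0 f -> mfun0 x ->
  (abs_pairing f x < +oo)%E -> mu.-integrable setT (fun t => (f t * x t)%:E).
Proof. by move=> mf mx fx; apply/integrableP; split => //; exact: measurable_pairing. Qed.

(** The general way into the dual: a single bound on absolute pairings yields integrability against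
    all of [E], boundedness of the dual values and the norm estimate. *)
Lemma dual_intro E f (C : R) : BIS E -> mfun0 f -> 0 <= C ->
  (forall x, ispace_set E x -> (abs_pairing f x <= (C * ispace_norm E x)%:E)%E) ->
  ispace_set (dual mu E) f /\ ispace_norm (dual mu E) f <= C.
Proof.
move=> [[mE _] _ _ _ _] mf C0 fC.
have intf x : ispace_set E x -> mu.-integrable setT (fun t => (f t * x t)%:E).
  move=> Ex; apply: integrable_pairing => //; first exact: mE.
  exact: le_lt_trans (fC _ Ex) (ltry _).
have ubC : ubound (dual_vals mu E f) C.
  move=> _ [x [Ex nx] <-]; apply: le_trans (ler_norm _) _.
  rewrite -lee_fin EFin_normr_Rintegral //; last exact: intf.
  apply: le_trans (le_abse_integral _ _ _) _ => //.
    by apply: measurable_pairing => //; exact: mE.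
  by have := fC _ Ex; rewrite nx mulr1.
split; first by split=> //; split=> //; exists C.
rewrite /=.
(* If [E] has no element of norm 1, the supremum is that of the empty set, which is 0 by convention;
   this case uses [0 <= C]. *)
have [->|/set0P ne] := eqVneq (dual_vals mu E f) set0; last exact: ge_sup.
by rewrite sup0.
Qed.

(** The unit sphere is symmetric: [x] and [-x] give opposite values, both at most the supremum. *)
Lemma dual_norm_ge0 E f : BIS E -> ispace_set (dual mu E) f ->
  0 <= ispace_norm (dual mu E) f.
Proof.
move=> bE [mf [intf ubf]] /=.
case: (bE) => _ [_ [_ EZ]] [_ [nZ _]] _ _.
have [->|/set0P [_ [x [Ex nx] _]]] := eqVneq (dual_vals mu E f) set0.
  by rewrite sup0.
have h1 : Rintegral mu setT (fun t => f t * x t) <= sup (dual_vals mu E f).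
  by apply: ub_le_sup => //; exists x.
have h2 : Rintegral mu setT (fun t => f t * (-1 * x t)) <= sup (dual_vals mu E f).
  apply: ub_le_sup => //; exists (fun t => -1 * x t) => //.
  by split; [exact: EZ|rewrite nZ // normrN1 mul1r].
have : Rintegral mu setT (fun t => f t * (-1 * x t)) =
    -1 * Rintegral mu setT (fun t => f t * x t).
  rewrite -RintegralZl //; last exact: intf.
  by apply: eq_Rintegral => t _; ring.
lra.
Qed.

(** Converse to [dual_intro]: the supremum of signed integrals over the unit sphere already controls
    the absolute pairing, since signs can be absorbed into the test function. *)
Lemma dual_holder E f x : BIS E -> ispace_set (dual mu E) f -> ispace_set E x ->
  (abs_pairing f x <= (ispace_norm (dual mu E) f * ispace_norm E x)%:E)%E.
Proof.
move=> bE Ef Ex; have f0 := dual_norm_ge0 bE Ef.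
case: (bE) => -[mE eqE] [_ [_ EZ]] [n0 [nZ _]] _ solid.
case: (Ef) => mf [intf ubf].
(* [y] has the sign of [f] and the modulus of [x], so that [f y = |f x|]. *)
pose y t := if 0 <= f t then `|x t| else - `|x t|.
have fy t : f t * y t = `|f t * x t|.
  rewrite /y normrM; case: ifPn => [f0'|]; first by rewrite ger0_norm.
  by rewrite -ltNge => f0'; rewrite ltr0_norm // mulrN mulNr.
have my : mfun0 y.
  apply: measurable_fun_ifT.
  - exact: (measurable_fun_ler (@mfun0_cst 0) mf).
  - exact: mfun0_norm (mE _ Ex).
  - exact: (measurableT_comp (@oppr_measurable R setT) (mfun0_norm (mE _ Ex))).
have [Ey nyx] : ispace_set E y /\ ispace_norm E y <= ispace_norm E x.
  apply: solid => //; apply: aeW => t; rewrite /y.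
  by case: ifP; rewrite ?normrN normr_id.
have -> : abs_pairing f x = (\int[mu]_t (f t * y t)%:E)%E.
  by apply: eq_integral => t _; rewrite fy.
have fin_fy : (\int[mu]_t (f t * y t)%:E)%E \is a fin_num.
  exact: integrable_fin_num (intf _ Ey).
apply: (@le_trans _ _ (ispace_norm (dual mu E) f * ispace_norm E y)%:E); last first.
  by rewrite lee_fin ler_wpM2l.
have [ny_ge0 ny0] := n0 _ Ey.
(* If the norm of [y] is 0, then [y] vanishes a.e. and so does the integral; otherwise [y] is
   normalised to a competitor in the supremum. *)
have [ny|ny] := eqVneq (ispace_norm E y) 0.
  rewrite (_ : (\int[mu]_t (f t * y t)%:E)%E = 0%E) ?lee_fin ?mulr_ge0 //.
  rewrite -(@integral0 _ _ _ mu setT); apply: ae_eq_integral => //.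
    exact: measurable_pairing.
  by apply: filterS (ny0.1 ny) => t -> _; rewrite mulr0.
have ny_gt0 : 0 < ispace_norm E y by rewrite lt_def ny.
rewrite -(fineK fin_fy) lee_fin -ler_pdivrMr // mulrC.
rewrite -RintegralZl //; last exact: intf.
apply: ub_le_sup => //; exists (fun t => (ispace_norm E y)^-1 * y t).
  by split; [exact: EZ|rewrite nZ // ger0_norm ?invr_ge0 // mulVf].
by apply: eq_Rintegral => t _; ring.
Qed.

(** * The dual as a Banach ideal space *)

Lemma abs_pairing_eq0 f x : mfun0 f -> mfun0 x ->
  abs_pairing f x = 0%E -> ae_eq mu (f \* x) (fun=> 0).
Proof.
move=> mf mx /(ae_eq_integral_abs mu measurableT (measurable_pairing mf mx)).
by apply: filterS => t /(_ Logic.I) [].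
Qed.

(* By monotone convergence the series [\sum_k |g k|] is finite a.e. on the
   support of each [x] in [E]; maximal width makes it finite a.e. on the whole
   space. *)
Lemma dual_series_ae E (g : nat -> T -> R) (c : nat -> R) :
  BIS E -> max_width mu (ispace_set E) ->
  (forall k, ispace_set (dual mu E) (g k)) ->
  (forall k, ispace_norm (dual mu E) (g k) <= c k) ->
  (\sum_(0 <= k <oo) (c k)%:E < +oo)%E ->
  {ae mu, forall t, (\sum_(0 <= k <oo) `|g k t|%:E < +oo)%E}.
Proof.
move=> bE wE Eg gc cfin.
pose h t := (\sum_(0 <= k <oo) `|g k t|%:E)%E.
have mg k : mfun0 (g k) by case: (Eg k).
have c0 k : 0 <= c k by apply: le_trans (gc k); exact: dual_norm_ge0.
have mh : measurable_fun setT h.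
  apply: ge0_emeasurable_sum => // k _; apply/measurable_EFinP.
  exact: mfun0_norm.
have mA : measurable (h @^-1` [set +oo%E]).
  by rewrite -[X in measurable X]setTI; exact: mh.
(* Maximal width is tested on the indicator of the set where the series diverges. *)
have : ae_eq mu (\1_(h @^-1` [set +oo%E]) : T -> R) (fun=> 0).
  apply: wE => [|y Ey]; first exact: measurable_indic.
  have my : mfun0 y by case: (bE) => -[/(_ _ Ey)].
  pose s t := (\sum_(0 <= k <oo) `|g k t * y t|%:E)%E.
  have ms : measurable_fun setT s.
    by apply: ge0_emeasurable_sum => // k _; exact: measurable_abs_pairing.
  have s0 t : (0 <= s t)%E by exact: nneseries_ge0.
  have sy t : s t = (`|y t|%:E * h t)%E.
    rewrite -nneseriesZl //; apply: eq_eseriesr => k _.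
    by rewrite normrM mulrC EFinM.
  have /integrable_ae-/(_ measurableT) : mu.-integrable setT s.
    apply/integrableP; split => //.
    under eq_integral do rewrite gee0_abs //.
    rewrite integral_nneseries //; last by move=> k; exact: measurable_abs_pairing.
    apply: (@le_lt_trans _ _ (\sum_(0 <= k <oo) ((ispace_norm E y)%:E * (c k)%:E))%E).
      apply: lee_nneseries => [k _ _|k _]; first exact: integral_ge0.
      apply: le_trans (dual_holder bE (Eg k) Ey) _.
      rewrite -EFinM lee_fin mulrC ler_wpM2l //.
      by case: (bE) => _ _ [/(_ _ Ey)[]].
    rewrite nneseriesZl => [|k _]; last by rewrite lee_fin.
    rewrite lte_mul_pinfty ?lee_fin //.
    by case: (bE) => _ _ [/(_ _ Ey)[]].
  apply: filterS => t /(_ Logic.I) /=; rewrite sy indicE.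
  case: (boolP (t \in _)) => [|_]; last by rewrite mul0r.
  (* Where [h] is infinite, finiteness of [s t = |y t| * h t] forces [y t = 0]. *)
  rewrite inE /= => ->; have [->|y0] := eqVneq (y t) 0; first by rewrite mulr0.
  by rewrite gt0_muley // lte_fin normr_gt0.
apply: filterS => t; rewrite indicE => t0.
rewrite ltey; apply/eqP => ht; move/eqP: t0.
by rewrite mem_set // oner_eq0.
Qed.

Lemma limn_einf_le (u : nat -> \bar R) (C : \bar R) :
  (forall k, (u k <= C)%E) -> (limn_einf u <= C)%E.
Proof.
move=> uC; rewrite limn_einf_lim; apply: lime_le; first exact: is_cvg_einfs.
apply: nearW => n; apply: le_trans (uC n).
by apply: ereal_inf_lbound; exists n => /=.
Qed.

Lemma measurable_limn_einf (p : nat -> T -> \bar R) :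
  (forall k, measurable_fun setT (p k)) ->
  measurable_fun setT (fun t => limn_einf (p ^~ t)).
Proof.
move=> mp; apply: (measurableT_comp (@oppe_measurable R setT)).
apply: measurable_fun_limn_esup => k.
exact: (measurableT_comp (@oppe_measurable R setT) (mp k)).
Qed.

(** The sequence is its initial term plus the partial sums of an absolutely convergent telescoping
    series. *)
Lemma is_cvg_summable_increments (a : nat -> R) :
  (\sum_(0 <= k <oo) `|a k.+1 - a k|%:E < +oo)%E -> cvgn a.
Proof.
move=> afin.
have /normed_cvg cv : cvgn [normed series (telescope a)].
  by apply: nnseries_is_cvg => // k; exact: normr_ge0.
rewrite (_ : a = cst (a 0%N) \+ series (telescope a)).
  by apply: is_cvgD => //; exact: is_cvg_cst.
by apply/funext => n /=; rewrite -eq_sum_telescope.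
Qed.

Lemma dual_add E f g : BIS E -> ispace_set (dual mu E) f ->
  ispace_set (dual mu E) g ->
  ispace_set (dual mu E) (f \+ g) /\
  ispace_norm (dual mu E) (f \+ g) <=
    ispace_norm (dual mu E) f + ispace_norm (dual mu E) g.
Proof.
move=> bE Ef Eg; have [[mf _] [mg _]] := (Ef, Eg).
apply: dual_intro => //; first exact: (measurable_funD mf mg).
  by rewrite addr_ge0 // dual_norm_ge0.
move=> x Ex; have mx : mfun0 x by case: (bE) => -[/(_ _ Ex)].
apply: le_trans (abs_pairingD mf mg mx) _.
by rewrite mulrDl EFinD leeD // dual_holder.
Qed.

(** For [a] nonzero, the reverse inequality comes from applying this one again with [a^-1]. *)
Lemma dual_scale_le E f (a : R) : BIS E -> ispace_set (dual mu E) f ->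
  ispace_set (dual mu E) (fun t => a * f t) /\
  ispace_norm (dual mu E) (fun t => a * f t) <= `|a| * ispace_norm (dual mu E) f.
Proof.
move=> bE Ef; have [mf _] := Ef.
apply: dual_intro => //; first exact: mfun0M (mfun0_cst _) mf.
  by rewrite mulr_ge0 // dual_norm_ge0.
move=> x Ex; have mx : mfun0 x by case: (bE) => -[/(_ _ Ex)].
by rewrite abs_pairingZ // -mulrA EFinM lee_wpmul2l // dual_holder.
Qed.

Lemma dual_solid E f g : BIS E -> ispace_set (dual mu E) g -> mfun0 f ->
  ae_le mu (fun t => `|f t|) (fun t => `|g t|) ->
  ispace_set (dual mu E) f /\
  ispace_norm (dual mu E) f <= ispace_norm (dual mu E) g.
Proof.
move=> bE Eg mf fg; have [mg _] := Eg.
apply: dual_intro => //; first exact: dual_norm_ge0.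
move=> x Ex; have mx : mfun0 x by case: (bE) => -[/(_ _ Ex)].
apply: le_trans (dual_holder bE Eg Ex); apply: le_abs_pairing => //.
by apply: filterS fg => t fg; rewrite !normrM ler_wpM2r.
Qed.

Lemma dual_complete E (u : nat -> T -> R) : BIS E ->
  max_width mu (ispace_set E) ->
  (forall k, ispace_set (dual mu E) (u k)) ->
  (forall e : R, 0 < e -> exists N, forall m k, (N <= m)%N -> (N <= k)%N ->
     ispace_norm (dual mu E) (u m \- u k) < e) ->
  exists2 f, ispace_set (dual mu E) f &
    forall e : R, 0 < e -> exists N, forall k, (N <= k)%N ->
      ispace_norm (dual mu E) (u k \- f) < e.
Proof.
move=> bE wE Eu cu.
have dual_sub v w : ispace_set (dual mu E) v -> ispace_set (dual mu E) w ->
    ispace_set (dual mu E) (v \- w).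
  move=> Ev Ew; have [Ew' _] := dual_scale_le (-1) bE Ew.
  rewrite (_ : _ \- _ = v \+ (fun t => -1 * w t)); first by case: (dual_add bE Ev Ew').
  by apply/funext => t /=; rewrite mulN1r.
(* Increments of the subsequence will be at most [2^-(k+1)], with total sum at most 1. *)
pose c k : R := 1 / (2 ^ k.+1)%:R.
have c_gt0 k : 0 < c k by rewrite divr_gt0 // ltr0n expn_gt0.
have /choice[N NP] k := cu _ (c_gt0 k).
(* The sum makes [M] nondecreasing and at least each [N k]; the added [k] makes it tend to
   infinity. *)
pose M k := (\sum_(j < k.+1) N j + k)%N.
have NM k : (N k <= M k)%N by rewrite /M big_ord_recr /= -addnA addnCA leq_addr.
have MS k : (M k <= M k.+1)%N.
  rewrite /M [in leqRHS]big_ord_recr /= -addnA leq_add2l.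
  by rewrite (leq_trans (leqnSn k)) // leq_addl.
have kM k : (k <= M k)%N by rewrite leq_addl.
pose g k := u (M k).
have mg k : mfun0 (g k) by case: (Eu (M k)).
have g_ae : {ae mu, forall t, (\sum_(0 <= k <oo) `|(g k.+1 \- g k) t|%:E < +oo)%E}.
  apply: (@dual_series_ae E (fun k => g k.+1 \- g k) c) => //.
  - by move=> k; exact: (dual_sub _ _ (Eu (M k.+1)) (Eu (M k))).
  - by move=> k; apply/ltW/NP => //; exact: leq_trans (NM k) (MS k).
  (* Applied to the zero series, [epsilon_trick] bounds the sum of the [c k] by 1. *)
  - have := @epsilon_trick R (fun=> 0%E) 1 xpredT (fun=> lexx _) ler01.
    rewrite [X in (_ <= X + _)%E]eseries0 // add0e => h; apply: le_lt_trans (ltry 1).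
    by apply: le_trans h; under [leRHS]eq_eseriesr do rewrite add0e.
(* The upper limit is defined and measurable everywhere, also on the null set where [g] may diverge;
   [fine] makes it real. *)
pose f t := fine (limn_esup (fun k => (g k t)%:E)).
have mf : mfun0 f.
  apply: (measurableT_comp (@fine_measurable R setT measurableT)).
  by apply: measurable_fun_limn_esup => k; apply/measurable_EFinP; exact: mg.
have gf : {ae mu, forall t, g k t @[k --> \oo] --> f t}.
  apply: filterS g_ae => t /is_cvg_summable_increments gt.
  have /cvg_limn_einf_sup[_ fE] : (g k t)%:E @[k --> \oo] --> (limn (g ^~ t))%:E.
    by apply: cvg_EFin => //; exact: nearW.
  by rewrite /f fE.
(* A bound on [u m - u k] for all large [k] passes to [u m - f] by Fatou's lemma. This gives both
   that [f] is in the dual and that it is the norm limit. *)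
have norm_limit m K (e : R) : 0 <= e ->
    (forall k, (K <= k)%N -> ispace_norm (dual mu E) (u m \- u k) <= e) ->
    ispace_set (dual mu E) (u m \- f) /\ ispace_norm (dual mu E) (u m \- f) <= e.
  move=> e0 ue; have mu_m : mfun0 (u m) by case: (Eu m).
  apply: dual_intro => //; first exact: mfun0B.
  move=> x Ex; have mx : mfun0 x by case: (bE) => -[/(_ _ Ex)].
  (* The shift by [K] puts every term in the range of the hypothesis, as [M (k + K) >= K]. *)
  pose p k t := `|(u m \- g (k + K)%N) t * x t|%:E.
  have mp k : measurable_fun setT (p k).
    by apply: measurable_abs_pairing => //; exact: mfun0B.
  apply: (@le_trans _ _ (\int[mu]_t limn_einf (p ^~ t))%E).
    apply: ae_ge0_le_integral => //.
    - by apply: measurable_abs_pairing => //; exact: mfun0B.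
    - move=> t _; rewrite limn_einf_lim; apply: lime_ge; first exact: is_cvg_einfs.
      by apply: nearW => n; apply: le_ereal_inf_tmp => _ [k _ <-]; rewrite lee_fin.
    - exact: measurable_limn_einf.
    - apply: filterS gf => t; rewrite -(cvg_shiftn K) => gt _.
      have /cvg_limn_einf_sup[-> _] // : p k t @[k --> \oo] --> `|(u m \- f) t * x t|%:E.
      apply: cvg_EFin; first exact: nearW.
      apply: cvg_norm; apply: cvgM; last exact: cvg_cst.
      by apply: cvgB; [exact: cvg_cst|exact: gt].
  have p0 k t : setT t -> (0 <= p k t)%E by rewrite lee_fin.
  apply: (le_trans (fatou mu measurableT mp p0)).
  apply: limn_einf_le => k.
  apply: le_trans (dual_holder bE (dual_sub _ _ (Eu m) (Eu _)) Ex) _.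
  rewrite lee_fin ler_wpM2r //; first by case: (bE) => _ _ [/(_ _ Ex)[]].
  by apply: ue; rewrite (leq_trans _ (kM _)) // leq_addl.
exists f.
  (* Membership of [f] follows from [f = u K - (u K - f)]. *)
  have [K /(_ _ _ (leqnn K)) PK] := cu _ ltr01.
  have [EuK _] := norm_limit K K 1 ler01 (fun k h => ltW (PK k h)).
  have := dual_sub _ _ (Eu K) EuK.
  rewrite (_ : _ \- _ = f) //.
  by apply/funext => t /=; rewrite subKr.
move=> e e0; have e20 : 0 < e / 2 by rewrite divr_gt0.
have [K PK] := cu _ e20; exists K => m Km.
have [_] := norm_limit m K _ (ltW e20) (fun k h => ltW (PK m k Km h)).
by move=> /le_lt_trans; apply; rewrite ltr_pdivrMr // ltr_pMr // ltr1n.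
Qed.

Lemma is_BIS_dual E : BIS E -> max_width mu (ispace_set E) -> BIS (dual mu E).
Proof.
move=> bE wE.
have zero_dual : ispace_set (dual mu E) (fun=> 0) /\
    ispace_norm (dual mu E) (fun=> 0) <= 0.
  apply: dual_intro => // [|x Ex]; first exact: mfun0_cst.
  by rewrite mul0r /abs_pairing; under eq_integral do rewrite mul0r normr0; rewrite integral0.
split.
- split; first by move=> f [].
  move=> f g Ef mg fg; have [mf _] := Ef.
  have gf_le : ae_le mu (fun t => `|g t|) (fun t => `|f t|).
    by apply: filterS fg => t ->.
  have [Eg gf] := dual_solid bE Ef mg gf_le; split => //.
  apply/eqP; rewrite eq_le gf /=.
  have fg_le : ae_le mu (fun t => `|f t|) (fun t => `|g t|).
    by apply: filterS fg => t ->.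
  by case: (dual_solid bE Eg mf fg_le).
- split; first by case: zero_dual.
  split; first by move=> f g Ef Eg; case: (dual_add bE Ef Eg).
  by move=> a f Ef; case: (dual_scale_le a bE Ef).
- split; [|split].
  + move=> f Ef; have f0 := dual_norm_ge0 bE Ef; have [mf _] := Ef; split=> //.
    split=> [nf|f_ae].
      (* Definiteness: by Hoelder's inequality [f * x] vanishes a.e. for each [x] in [E], and [E]
         has maximal width. *)
      apply: wE => // x Ex.
      have mx : mfun0 x by case: (bE) => -[/(_ _ Ex)].
      apply: abs_pairing_eq0 => //; apply/eqP; rewrite eq_le integral_ge0 // andbT.
      by have := dual_holder bE Ef Ex; rewrite nf mul0r.
    apply/eqP; rewrite eq_le f0 andbT.
    have [E0 n0] := zero_dual; apply: le_trans n0.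
    have f_le : ae_le mu (fun t => `|f t|) (fun t => `|(fun=> 0 : R) t|).
      by apply: filterS f_ae => t ->.
    by case: (dual_solid bE E0 mf f_le).
  + move=> a f Ef; have [Eaf af] := dual_scale_le a bE Ef.
    apply/eqP; rewrite eq_le af /=.
    have [->|a0] := eqVneq a 0.
      rewrite normr0 mul0r; apply: dual_norm_ge0 => //.
      by case: (dual_scale_le 0 bE Ef).
    have [_] := dual_scale_le a^-1 bE Eaf.
    rewrite (_ : (fun t => a^-1 * (a * f t)) = f).
      by rewrite normfV mulrC ler_pdivlMr ?normr_gt0 // mulrC.
    by apply/funext => t; rewrite mulKf.
  + by move=> f g Ef Eg; case: (dual_add bE Ef Eg).
- by move=> u Eu cu; exact: dual_complete.
- by move=> f g Eg mf fg; exact: dual_solid.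
Qed.

(** * Duality and the two closure operators *)

Lemma sub1_dual E F : BIS E -> BIS F -> sub1 E F -> sub1 (dual mu F) (dual mu E).
Proof.
move=> bE bF [EF nEF].
suff H f : ispace_set (dual mu F) f -> ispace_set (dual mu E) f /\
    ispace_norm (dual mu E) f <= ispace_norm (dual mu F) f.
  by split=> f /H[].
move=> Ff; have [mf _] := Ff; have f0 := dual_norm_ge0 bF Ff.
apply: dual_intro => // x Ex; apply: le_trans (dual_holder bF Ff (EF _ Ex)) _.
by rewrite lee_fin ler_wpM2l // nEF.
Qed.

(** The pairing is symmetric, so Hoelder's inequality for [f] in [E'] is also the bound that puts
    [x] in the dual of [E']. *)
Lemma sub1_bidual E : BIS E -> max_width mu (ispace_set E) ->
  sub1 E (dual mu (dual mu E)).
Proof.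
move=> bE wE; have bE' := is_BIS_dual bE wE.
suff H x : ispace_set E x -> ispace_set (dual mu (dual mu E)) x /\
    ispace_norm (dual mu (dual mu E)) x <= ispace_norm E x.
  by split=> x /H[].
move=> Ex; apply: dual_intro => //; first by case: (bE) => -[/(_ _ Ex)].
  by case: (bE) => _ _ [/(_ _ Ex)[]].
move=> f Ef; have := dual_holder bE Ef Ex; rewrite mulrC /abs_pairing.
by under [X in _ -> (X <= _)%E]eq_integral do rewrite mulrC.
Qed.

Lemma max_width_sub (A B : set (T -> R)) : A `<=` B -> max_width mu A ->
  max_width mu B.
Proof. by move=> AB wA z mz zB; apply: wA => // y /AB; exact: zB. Qed.

Lemma sub1_anti E F : sub1 E F -> sub1 F E -> ispace_eq E F.
Proof.
move=> [EF nEF] [FE nFE]; split; first by apply/seteqP.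
by move=> x Ex; apply/eqP; rewrite eq_le nEF // nFE //; exact: EF.
Qed.

Lemma foundation_ocpart E : BIS E -> max_width mu (order_continuous_elt mu E) ->
  foundation mu (ispace_set (ocpart mu E)) E.
Proof. by move=> bE wE; split => //; exact: order_continuous_ideal. Qed.

Lemma ocpart_mono E F : BIS E -> sub1 E F -> sub1 (ocpart mu E) (ocpart mu F).
Proof.
by move=> bE EF; split=> x; [exact: order_continuous_sub1|case=> /EF.2].
Qed.

(** The net condition involves [E] only through its norm, which [ocpart] keeps, so it is the same
    condition for [E_0] as for [E]. *)
Lemma ocpart_idem E : BIS E -> ispace_eq (ocpart mu (ocpart mu E)) (ocpart mu E).
Proof.
move=> bE; split=> //; apply/seteqP; split=> x; first by case.
by move=> ocx; split=> //; case: ocx.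
Qed.

Lemma J0_ocpart E : J0 mu E -> J0 mu (ocpart mu E).
Proof.
move=> [bE wE [_ w0] [_ wd]]; have bE0 := is_BIS_ocpart bE.
have bE' := is_BIS_dual bE wE; have bE0' := is_BIS_dual bE0 w0.
split=> //; apply: foundation_ocpart => //.
  by move: w0; have [<- _] := ocpart_idem bE.
apply: max_width_sub wd => f; apply: order_continuous_sub1 => //.
exact: sub1_dual (ocpart_sub1 E).
Qed.

Lemma J0_bidual E : J0 mu E -> J0 mu (dual mu (dual mu E)).
Proof.
move=> [bE wE [_ w0] [_ wd]].
have bE' := is_BIS_dual bE wE.
(* [E'] contains [(E')_0], which has maximal width; this is what makes [E''] a Banach ideal
   space. *)
have wE' : max_width mu (ispace_set (dual mu E)).
  by apply: max_width_sub wd => f [].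
have bE'' := is_BIS_dual bE' wE'.
have EE'' := sub1_bidual bE wE.
have wE'' : max_width mu (ispace_set (dual mu (dual mu E))).
  by apply: max_width_sub wE; case: EE''.
split=> //; apply: foundation_ocpart => //.
- by apply: max_width_sub w0 => x; exact: order_continuous_sub1.
- exact: is_BIS_dual.
- apply: max_width_sub wd => x; apply: order_continuous_sub1 => //.
  exact: sub1_bidual.
Qed.

End BanachIdealSpaces.

Theorem theorem8 (d : measure_display) (T : measurableType d) (R : realType)
    (mu : {measure set T -> \bar R}) :
  admissible mu ->
  (* (a) E |-> E_0 is a closure operator w.r.t. E <| F :<-> F \subset^1 E *)
  (forall E F : @ispace _ T R, J0 mu E -> J0 mu F ->
     [/\ J0 mu (ocpart mu E),
         (sub1 F E -> sub1 (ocpart mu F) (ocpart mu E)),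
         sub1 (ocpart mu E) E
       & ispace_eq (ocpart mu (ocpart mu E)) (ocpart mu E)]) /\
  (* (b) E |-> E'' is a closure operator w.r.t. \subset^1 *)
  (forall E F : @ispace _ T R, J0 mu E -> J0 mu F ->
     [/\ J0 mu (dual mu (dual mu E)),
         (sub1 E F -> sub1 (dual mu (dual mu E)) (dual mu (dual mu F))),
         sub1 E (dual mu (dual mu E))
       & ispace_eq (dual mu (dual mu (dual mu (dual mu E)))) (dual mu (dual mu E))]).
Proof.
move=> _; split=> E F JE JF; have [bE wE _ [_ wE0']] := JE; have [bF wF _ [_ wF0']] := JF.
  split; [exact: J0_ocpart|exact: ocpart_mono|exact: ocpart_sub1|exact: ocpart_idem].
have bE' := is_BIS_dual bE wE; have bF' := is_BIS_dual bF wF.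
have wE' : max_width mu (ispace_set (dual mu E)).
  by apply: max_width_sub wE0' => f [].
have [bE'' wE'' _ _] := J0_bidual JE.
split; first exact: J0_bidual.
- by move=> EF; do 2!apply: sub1_dual => //.
- exact: sub1_bidual.
(* One inclusion is that of [E''] in its own bidual; the other is the dual of the inclusion of [E']
   in [E''']. *)
- apply: sub1_anti; last exact: sub1_bidual.
  by apply: sub1_dual (sub1_bidual bE' wE') => //; exact: is_BIS_dual.
Qed.
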